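(* Let $G=(V,E,\omega)$ be an infinite weighted graph as in the context, and let $p>1$, $q>0$. If $r>1$ and $u_0\in\ell^r(V)$, then the initial value problem $$\begin{cases}\partial_t u(x,t)=\Delta_p u^q(x,t), & x\in V,\ t>0,\\ u(x,0)=u_0(x), & x\in V,\end{cases}$$ admits an exhaustion solution $u\in L^\infty([0,+\infty);\ell^r(V))$.
   Context: Graph: $G=(V,E,\omega)$ is an infinite, connected, countable weighted graph with no multiple edges or self-loops; $\omega:V\times V\to[0,\infty)$ is symmetric and $\omega_{xy}=\omega(x,y)>0$ if and only if $\{x,y\}\in E$ (written $x\sim y$). Every vertex has finite degree, $\mu(x)=\sum_{y\sim x}\omega_{xy}$, and $\mu_0:=\inf_{x\in V}\mu(x)>0$. $d(x,y)$ is the graph distance (minimum number of edges of a path joining $x,y$), and $B_R(x_0)=\{x\in V: d(x,x_0)\le R\}$. Norms: $\|f\|_{\ell^r(V)}=\big(\sum_{x\in V}|f(x)|^r\mu(x)\big)^{1/r}$ for $r\ge1$. Powers: for $k\in\mathbb R$, $s>0$, $k^s:=|k|^{s-1}k$ (so $0^s=0$). Operator: $\Delta_p u^q(x,t)=\frac1{\mu(x)}\sum_{y\in V}|u^q(y,t)-u^q(x,t)|^{p-2}(u^q(y,t)-u^q(x,t))\,\omega_{xy}$. Solution: a solution in $L^\infty([0,T);\ell^r(V))$ ($0<T\le+\infty$, $r\ge1$) is a function $u:V\times[0,T)\to\mathbb R$ with $u\in L^\infty([0,T);\ell^r(V))$, $u(x,\cdot)\in C^1([0,T))$ for all $x\in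 V$, satisfying the initial value problem pointwise. Exhaustion solution: fix $x_0\in V$. For $n\ge1$ consider the mixed problem $$\begin{cases}\partial_t u_n(x,t)=\Delta_p u_n^q(x,t), & x\in B_n(x_0),\ t>0,\\ u_n(x,0)=u_0(x), & x\in B_n(x_0),\\ u_n(x,t)=0,& x\notin B_n(x_0),\ t\ge0.\end{cases}$$ A solution $u\in L^\infty([0,+\infty);\ell^r(V))$ of the initial value problem is an exhaustion solution if there is a subsequence $n_k\to\infty$ with $u(x,t)=\lim_{k\to\infty}u_{n_k}(x,t)$ for all $(x,t)\in V\times[0,+\infty)$, where each $u_{n_k}$ is a solution of the mixed problem on $B_{n_k}(x_0)$. *)

(* Defs.v *)
From HB Require Import structures.
From mathcomp Require Import all_boot all_order all_algebra.
From mathcomp Require Import all_classical all_reals all_analysis.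

Set Implicit Arguments.
Unset Strict Implicit.
Unset Printing Implicit Defensive.

Import Order.TTheory GRing.Theory Num.Theory.
Import numFieldNormedType.Exports.

Local Open Scope classical_set_scope.
Local Open Scope ring_scope.

Section Graph.
Context {R : realType} {V : countType}.
Implicit Types (w : V -> V -> R) (x y : V).

(* The edge set is recovered from the weight: {x, y} is an edge iff w x y > 0. *)
Definition adj w : rel V := fun x y => 0 < w x y.

Definition vmeas w x : R := \sum_(y \in [set y | adj w x y]) w x y.

Definition walk w (n : nat) x y : Prop :=
  exists s : seq V, [/\ path (adj w) x s, last x s = y & size s = n].

Record weighted_graph w : Prop := WeightedGraph {
  wg_infinite : infinite_set [set: V];
  wg_ge0 : forall x y, 0 <= w x y;
  wg_sym : forall x y, w x y = w y x;
  wg_noloop : forall x, w x x = 0;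
  wg_locfin : forall x, finite_set [set y | adj w x y];
  wg_connected : forall x y, exists n, walk w n x y;
  wg_mu0 : 0 < inf (range (vmeas w))
}.

(* The default value 0 is irrelevant when the graph is connected. *)
Definition gdist w x y : nat :=
  xget 0%N [set n | walk w n x y /\ forall m, walk w m x y -> (n <= m)%N].

Definition gball w (x0 : V) (n : nat) : set V :=
  [set x | (gdist w x x0 <= n)%N].

Definition lnorm w (r : R) (f : V -> R) : \bar R :=
  ((\esum_(x in [set: V]) (`|f x| `^ r * vmeas w x)%:E) `^ r^-1)%E.

Definition lspace w (r : R) : set (V -> R) :=
  [set f | (lnorm w r f < +oo)%E].

Definition spow (k s : R) : R := `|k| `^ (s - 1) * k.

(* For p < 2 the product with the zero increment makes
   the terms with equal values vanish, whatever the value of 0 `^ (p - 2). *)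
Definition plaplace w (p : R) (f : V -> R) (x : V) : R :=
  (vmeas w x)^-1 *
  \sum_(y \in [set: V]) (`|f y - f x| `^ (p - 2) * (f y - f x) * w x y).

End Graph.

Section Solutions.
Context {R : realType} {V : countType}.
Implicit Types (w : V -> V -> R) (u : V -> R -> R) (T : \bar R).

Definition time_interval T : set R := [set t | 0 <= t /\ (t%:E < T)%E].

(* Derivative relative to I: one-sided at an endpoint belonging to I. *)
Definition has_deriv_within (I : set R) (f : R -> R) (t l : R) : Prop :=
  (f s - f t) / (s - t) @[s --> within I t^'] --> l.

Definition C1_on (I : set R) (f : R -> R) : Prop :=
  exists2 g : R -> R, {within I, continuous g}
    & forall t, I t -> has_deriv_within I f t (g t).

(* Membership in the Bochner space L^oo([0, T); l^r(V)).  For 1 <= r < +oo the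
   space l^r(V) is separable and its Borel sigma-algebra is generated by the
   coordinates, so strong measurability is measurability of each coordinate. *)
Definition Linfty_lspace w (r : R) T u : Prop :=
  [/\ forall t, time_interval T t -> lspace w r (u ^~ t),
      forall x, measurable_fun (time_interval T) (u x)
    & exists M : R, {ae lebesgue_measure,
        forall t : R, time_interval T t -> (lnorm w r (u ^~ t) <= M%:E)%E}].

Definition evolves_at w (p q : R) u (x : V) (t : R) : Prop :=
  is_derive t 1 (u x) (plaplace w p (fun y => spow (u y t) q) x).

Definition ivp_solution w (p q r : R) (u0 : V -> R) T u : Prop :=
  [/\ Linfty_lspace w r T u,
      forall x, C1_on (time_interval T) (u x),
      forall x (t : R), 0 < t -> (t%:E < T)%E -> evolves_at w p q u x t
    & forall x, u x 0 = u0 x].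

Definition mixed_solution w (p q : R) (u0 : V -> R) (x0 : V) (n : nat) u : Prop :=
  [/\ forall x, C1_on (time_interval +oo) (u x),
      forall x (t : R), gball w x0 n x -> 0 < t -> evolves_at w p q u x t,
      forall x, gball w x0 n x -> u x 0 = u0 x
    & forall x (t : R), ~ gball w x0 n x -> 0 <= t -> u x t = 0].

Definition exhaustion_solution w (p q r : R) (u0 : V -> R) (x0 : V) u : Prop :=
  ivp_solution w p q r u0 +oo u /\
  exists (un : nat -> V -> R -> R) (nk : nat -> nat),
    [/\ forall k, (1 <= nk k)%N,
        forall k, (nk k < nk k.+1)%N,
        forall k, mixed_solution w p q u0 x0 (nk k) (un (nk k))
      & forall x (t : R), 0 <= t -> un (nk k) x t @[k --> \oo] --> u x t].

End Solutions.

(* Main.v *)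
Require Import Defs.
From HB Require Import structures.
From mathcomp Require Import all_boot all_order all_algebra.
From mathcomp Require Import all_classical all_reals all_analysis.
From mathcomp Require Import measurable_realfun.
From mathcomp Require Import ring lra zify.

(** On a ball the problem is an ordinary differential equation in finitely many
unknowns, but its right-hand side is in general not Lipschitz (p < 2 or q < 1),
so that existence has to come from compactness; the passage from the balls to
the whole graph is a second compactness argument.  Both are instances of
[flow_limit]: a pointwise limit of approximate solutions is a solution.  It
works without integrals.  A curve is called an approximate solution when its
increment over [s, t] is close to (t - s) c as soon as its velocity stays close
to c on [s, t].  This passes to pointwise limits, and for a continuous vector
field it says exactly that the limit is differentiable with the right
derivative.  Euler schemes give approximate solutions ([euler_approx_flow]),
which gives Peano's theorem [peano_existence] for bounded continuous vector
fields; exact solutions on growing balls are approximate solutions on the whole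
graph by the mean value theorem, because every vertex is eventually inside the
ball.  Pointwise limits are taken along an ultrafilter on nat finer than
[\oo].  A subsequence is extracted once at the end ([pointwise_subsequence]):
convergence at the countably many pairs (vertex, rational time) suffices,
because all curves are Lipschitz with one constant.

The boundedness used in both steps comes from the energy, the sum of |u(x,
t)|^r mu(x). Its time derivative is, after summation by parts ([dissipation]),
minus a sum, with nonnegative weights, of products of increments of two
nondecreasing functions of u, hence nonpositive ([energy_nonincreasing]); r > 1
makes |s|^r differentiable. As mu is bounded below by mu0 > 0, the energy
controls |u| by a constant K independent of the vertex, the time and the ball.
The power u^q is therefore replaced from the outset by the power of u clamped
to [-K, K]. The truncated vector field is bounded, so its solutions are global
in time and uniformly Lipschitz; the energy estimate only uses that the
truncated power is nondecreasing, so it holds for the truncated equation too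
and shows that the truncation is never active. In the limit, the bounds on
finite partial sums of the energy give the bound in l^r. *)

Import Order.TTheory GRing.Theory Num.Theory.
Import numFieldNormedType.Exports.

Local Open Scope classical_set_scope.
Local Open Scope ring_scope.

Set Implicit Arguments.
Unset Strict Implicit.
Unset Printing Implicit Defensive.

(** * Signed powers *)

Section SignedPower.
Context {R : realType}.
Implicit Types (k s r : R).

Lemma spowE k s : 0 < s -> 0 <= k -> spow k s = k `^ s.
Proof. by move=> s0 k0; rewrite /spow ger0_norm// mulrC mulr_powRB1. Qed.

Lemma spowN k s : spow (- k) s = - spow k s.
Proof. by rewrite /spow normrN mulrN. Qed.

Lemma norm_spow k s : 0 < s -> `|spow k s| = `|k| `^ s.
Proof.
move=> s0; rewrite /spow normrM ger0_norm ?powR_ge0//.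
by rewrite mulrC mulr_powRB1.
Qed.

Lemma spow_ge0 k s : 0 <= k -> 0 <= spow k s.
Proof. by move=> k0; rewrite mulr_ge0// powR_ge0. Qed.

Lemma spow_le k l s : 0 < s -> k <= l -> spow k s <= spow l s.
Proof.
move=> s0 kl; have [k0|k0] := leP 0 k.
  have l0 : 0 <= l by exact: le_trans kl.
  by rewrite !spowE//; apply: ge0_ler_powR => //; rewrite ?nnegrE// ltW.
have [l0|l0] := leP 0 l.
  apply: (@le_trans _ _ 0); last exact: spow_ge0.
  by rewrite -oppr_ge0 -spowN spow_ge0// oppr_ge0 ltW.
have [k0' l0'] : 0 <= - k /\ 0 <= - l by rewrite !oppr_ge0 !ltW.
rewrite -lerN2 -!spowN !spowE//.
by apply: ge0_ler_powR; rewrite ?nnegrE ?lerN2// ltW.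
Qed.

Lemma spow_continuous s : 0 < s -> continuous (fun k : R => spow k s).
Proof.
move=> s0; have pos k : 0 < k -> spow l s @[l --> k] --> spow k s.
  move=> k0; have c : x `^ s @[x --> k] --> k `^ s.
    have [+ _] := is_derive1_powR s k0.
    by move=> /derivable1_diffP/differentiable_continuous.
  rewrite spowE ?ltW//; apply: cvg_trans c; apply: near_eq_cvg.
  by near do rewrite spowE ?ltW//; exact: lt_nbhsr.
move=> k; have [k0|k0|->] := ltgtP k 0; last 2 first.
- exact: pos.
- suff : spow l s @[l --> (0 : R)] --> (0 : R).
    by rewrite /continuous_at [X in _ -> (_ --> X)]mulr0.
  apply/cvgr0Pnorm_lt => e e0.
  have ep : 0 < e `^ s^-1 by rewrite powR_gt0.
  (* |h|^s < e as soon as |h| < e^(1/s). *)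
  exists (e `^ s^-1) => // h /=; rewrite sub0r normrN => hl.
  rewrite norm_spow// -[ltRHS]powRr1 ?ltW// -(mulVf (lt0r_neq0 s0)) powRrM.
  apply: gt0_ltr_powR; rewrite ?nnegrE ?normr_ge0 ?powR_ge0//.
- have k0' : 0 < - k by rewrite oppr_gt0.
  have -> : (fun h : R => spow h s) = (fun h => - spow (- h) s).
    by apply/funext => h; rewrite spowN opprK.
  apply: cvgN; apply: (@cvg_comp _ _ _ -%R (fun h : R => spow h s)) (pos _ k0').
  exact: oppr_continuous.
Unshelve. all: by end_near. Qed.

(** This form makes the difference quotient of |k|^r at 0 equal to
    [spow h (r - 1)], which tends to 0 since r > 1. *)
Lemma normr_powR_spow k r : 1 < r -> `|k| `^ r = spow k (r - 1) * k.
Proof.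
move=> r1; rewrite /spow -mulrA -expr2 -real_normK ?num_real// expr2 mulrA.
rewrite -[X in X * _]mulrC mulr_powRB1 ?subr_gt0// mulrC mulr_powRB1//.
exact: lt_trans r1.
Qed.

Lemma is_derive_normr_powR k r : 1 < r ->
  is_derive k 1 (fun h : R => `|h| `^ r) (r * spow k (r - 1)).
Proof.
move=> r1; have r0 : 0 < r by exact: lt_trans r1.
have pos (l : R) : 0 < l ->
    is_derive l 1 (fun h : R => `|h| `^ r) (r * spow l (r - 1)).
  move=> l0; rewrite spowE ?subr_gt0 ?ltW//.
  apply: (@near_eq_is_derive _ _ _ (@powR R ^~ r)).
    by near do rewrite ger0_norm ?ltW//; exact: lt_nbhsr.
  exact: is_derive1_powR.
have [k0|k0|k0] := ltgtP k 0; last 2 first.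
- exact: pos.
- rewrite k0.
  have dq :
    h^-1 *: (((fun h : R => `|h| `^ r) \o shift 0) (h *: 1) - `|0 : R| `^ r)
    @[h --> 0^'] --> r * spow (0 : R) (r - 1).
    rewrite [spow 0 _]mulr0 mulr0.
    have sp0 : spow (0 : R) (r - 1) = 0 by rewrite /spow mulr0.
    apply: (@cvg_trans _ (spow h (r - 1) @[h --> (0:R)^'])).
      apply: near_eq_cvg; near=> h.
      rewrite /= addr0 [h *: 1]mulr1 normr0 powR0 ?gt_eqF// subr0.
      rewrite normr_powR_spow// /GRing.scale/= [_^-1 * _]mulrC mulfK//.
      by near: h; exact: nbhs_dnbhs_neq.
    have s1 : 0 < r - 1 by rewrite subr_gt0.
    have := @spow_continuous _ s1 0; rewrite /continuous_at sp0; apply: cvg_trans.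
    by apply: cvg_app; exact: cvg_within.
  apply: DeriveDef; first by apply/cvg_ex; exists (r * spow (0 : R) (r - 1)).
  exact/cvg_lim.
- have k0' : 0 < - k by rewrite oppr_gt0.
  have -> : r * spow k (r - 1) = (r * spow (- k) (r - 1)) * -1.
    by rewrite spowN mulrN1 mulrN opprK.
  have -> : (fun h : R => `|h| `^ r) = (fun h : R => `|h| `^ r) \o -%R.
    by apply/funext => h /=; rewrite normrN.
  have dp := pos _ k0'; exact: is_derive1_comp.
Unshelve. all: by end_near. Qed.

End SignedPower.

(** * Limits of approximate solutions *)

Section ApproximateFlows.
Context {R : realType} {I : Type}.
Implicit Types (F : I -> (I -> R) -> R) (v : nat -> I -> R -> R) (e : nat -> R).

(** Continuity for the product topology on [I -> R], tested along arbitrary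
    filters: it is applied to filters on times and on pairs (index, time). *)
Definition ptws_continuous (G : (I -> R) -> R) : Prop :=
  forall (T : Type) (U : set_system T) (g : T -> I -> R) (f : I -> R),
    Filter U -> (forall i, g k i @[k --> U] --> f i) ->
    G (g k) @[k --> U] --> G f.

(** Solutions of u' = F(u) on [0, +oo), with a one-sided derivative at 0. *)
Definition flow F (u : I -> R -> R) : Prop :=
  forall x t, 0 <= t ->
    has_deriv_within (time_interval +oo) (u x) t (F x (u ^~ t)).

(** The error term [e k] absorbs the time step of a discretization.  The
    restriction to large [k], depending on [x], allows the [v k] to be solutions
    on balls, which satisfy the equation at [x] once the ball contains [x]. *)
Definition approx_flow F v e : Prop :=
  forall x, \forall k \near \oo, forall s t c eps, 0 <= s -> s <= t ->
    (forall tau, s <= tau <= t -> `|F x (v k ^~ tau) - c| <= eps) ->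
    `|v k x t - v k x s - (t - s) * c| <= eps * (t - s) + (`|c| + eps) * e k.

(** An ultrafilter makes bounded real sequences converge simultaneously for any
    index set [J], so no diagonal extraction is needed at this stage. *)
Lemma ultrafilter_pointwise_limit (J : Type) (U : set_system nat)
    (a : nat -> J -> R) : UltraFilter U ->
  (forall j, exists C : R, forall k, `|a k j| <= C) ->
  exists A : J -> R, forall j, a k j @[k --> U] --> A j.
Proof.
move=> UU bnd.
suff /choice[A Ah] : forall j, exists l : R, a k j @[k --> U] --> l by exists A.
move=> j; have [C aC] := bnd j.
have aCC : (fmap (fun k => a k j) U) `[- C, C]%classic.
  by apply: (@filterE _ U) => k /=; rewrite in_itv/= -ler_norml.
have [l [_ cl]] := @segment_compact R (- C) C _ _ aCC.
exists l => B lB; have [//|nB] := in_ultra_setVsetC ((fun k => a k j) @^-1` B) UU.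
by have [y []] := cl (~` B) B nB lB.
Qed.

Lemma eventually_ultrafilter :
  exists U : set_system nat, UltraFilter U /\ \oo `<=` U.
Proof. exact: ultraFilterLemma. Qed.

Section Limit.
Variables (F : I -> (I -> R) -> R) (v : nat -> I -> R -> R) (e : nat -> R).
Variable (M : R).
Hypothesis (bF : forall x f, `|F x f| <= M).
Hypothesis (vF : approx_flow F v e).

(** The same estimate without assuming s <= t: the derivative of the limit at an
    interior time needs increments on both sides. *)
Lemma approx_flow_dist x : \forall k \near \oo, forall s t c eps,
    0 <= s -> 0 <= t ->
    (forall tau, 0 <= tau -> `|tau - s| <= `|t - s| ->
      `|F x (v k ^~ tau) - c| <= eps) ->
    `|v k x t - v k x s - (t - s) * c| <= eps * `|t - s| + (`|c| + eps) * e k.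
Proof.
have := vF x; apply: filterS => k vk s t c eps s0 t0 near_c.
have [st|/ltW ts] := leP s t.
  rewrite (ger0_norm (_ : 0 <= t - s)) ?subr_ge0//; apply: vk => // tau /andP[].
  move=> stau taut; apply: near_c; first exact: le_trans stau.
  by rewrite !ger0_norm ?subr_ge0 ?lerD2r.
rewrite (distrC t s) (ger0_norm (_ : 0 <= s - t)) ?subr_ge0// -normrN.
have -> : - (v k x t - v k x s - (t - s) * c) = v k x s - v k x t - (s - t) * c.
  by ring.
apply: vk => // tau /andP[ttau taus]; apply: near_c; first exact: le_trans ttau.
by rewrite distrC (distrC t) !ger0_norm ?subr_ge0// lerD2l lerN2.
Qed.

(** The case c = 0 and eps = M. *)
Lemma approx_flow_lipschitz x : \forall k \near \oo, forall s t,
  0 <= s -> 0 <= t -> `|v k x t - v k x s| <= M * `|t - s| + M * e k.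
Proof.
have := approx_flow_dist x; apply: filterS => k vk s t s0 t0.
have := vk s t 0 M s0 t0; rewrite mulr0 subr0 normr0 add0r; apply => tau _ _.
by rewrite subr0 bF.
Qed.

Hypothesis (cF : forall x, ptws_continuous (F x)).
Hypothesis (e0 : e k @[k --> \oo] --> (0 : R)).
Context (U : set_system nat) {PU : ProperFilter U} (ooU : \oo `<=` U).
Variable (u : I -> R -> R).
Hypothesis (vu : forall x t, 0 <= t -> v k x t @[k --> U] --> u x t).

Let eU : e k @[k --> U] --> (0 : R).
Proof. by apply: cvg_trans e0; exact: cvg_app. Qed.

Lemma flow_limit_lipschitz x s t : 0 <= s -> 0 <= t ->
  `|u x t - u x s| <= M * `|t - s|.
Proof.
move=> s0 t0.
have lhs : `|v k x t - v k x s| @[k --> U] --> `|u x t - u x s|.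
  by apply: cvg_norm; apply: cvgB; exact: vu.
have rhs : M * `|t - s| + M * e k @[k --> U] --> M * `|t - s| + M * 0.
  by apply: cvgD; [exact: cvg_cst|apply: cvgM => //; exact: cvg_cst].
have := ler_cvg_to lhs rhs; rewrite mulr0 addr0; apply.
by apply: ooU; have := approx_flow_lipschitz x; apply: filterS => k; exact.
Qed.

(** The velocity of [v k] at time tau tends to F(u(t)) when [k] runs along [U] and
    tau tends to t simultaneously, by the common Lipschitz bound.  The
    approximate increments near t are thus within eps of (s - t) F(u(t)), and
    this inequality passes to the limit in [k] for fixed s. *)
Lemma flow_limit : flow F u.
Proof.
move=> x t t0; set c := F x _.
pose W := within (time_interval +oo) (nbhs t).
have cW : F x (v k.1 ^~ k.2) @[k --> filter_prod U W] --> c.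
  apply: cF => y; apply/cvgrPdist_le => eps eps0.
  (* eps/2 for the convergence at time t, and twice eps/4 for the Lipschitz
     bound: the distance between the times and the error term. *)
  have eps2 : 0 < eps / 2 by rewrite divr_gt0.
  have eps4 : 0 < eps / 4 by rewrite divr_gt0.
  have M1 : 0 < `|M| + 1 by rewrite ltr_wpDl.
  have near_t : \forall k \near U, `|u y t - v k y t| <= eps / 2.
    by have /cvgrPdist_le := @vu y t t0; exact.
  have near_e : \forall k \near U, `|0 - M * e k| <= eps / 4.
    have : M * e k @[k --> U] --> (0 : R).
      by rewrite -(mulr0 M); apply: cvgM => //; exact: cvg_cst.
    by move/cvgrPdist_le; exact.
  pose P := [set k | [/\ `|u y t - v k y t| <= eps / 2, `|0 - M * e k| <= eps / 4
    & forall s r, 0 <= s -> 0 <= r ->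
        `|v k y r - v k y s| <= M * `|r - s| + M * e k]].
  have UP : U P.
    have /ooU Ul := approx_flow_lipschitz y.
    by apply: filterS3 near_t near_e Ul.
  pose Q := [set tau | 0 <= tau /\ M * `|tau - t| <= eps / 4].
  have WQ : W Q.
    exists (eps / 4 / (`|M| + 1)); first by rewrite /= divr_gt0.
    move=> tau /=; rewrite distrC => taut [tau0 _]; split => //.
    apply: (@le_trans _ _ ((`|M| + 1) * `|tau - t|)).
      by rewrite ler_wpM2r// (le_trans (ler_norm _))// lerDl.
    by rewrite mulrC -ler_pdivlMr// ltW.
  exists (P, Q) => //= -[k tau] /= [[kt ke kl] [tau0 taut]].
  have := kl _ _ t0 tau0; move: kt ke; rewrite !ler_norml => /andP[? ?] /andP[? ?].
  by move=> /andP[? ?]; apply/andP; split; lra.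
apply/cvgrPdist_le => eps eps0.
have /cvgrPdist_le/(_ _ eps0) := cW.
move=> [[P Q]/= [UP [d /= d0 WQ]] PQ].
exists d => //= s; rewrite /ball_/= => sd st [s0 _].
suff : `|u x s - u x t - (s - t) * c| <= eps * `|s - t|.
  have st0 : s - t != 0 by rewrite subr_eq0.
  have -> : u x s - u x t - (s - t) * c =
      - (c - (u x s - u x t) / (s - t)) * (s - t).
    by field.
  by rewrite normrM normrN ler_pM2r ?normr_gt0.
have lhs : `|v k x s - v k x t - (s - t) * c| @[k --> U] -->
    `|u x s - u x t - (s - t) * c|.
  by apply: cvg_norm; apply: cvgB; [apply: cvgB; exact: vu|exact: cvg_cst].
have rhs : eps * `|s - t| + (`|c| + eps) * e k @[k --> U] -->
    eps * `|s - t| + (`|c| + eps) * 0.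
  by apply: cvgD; [exact: cvg_cst|apply: cvgM => //; exact: cvg_cst].
have := ler_cvg_to lhs rhs; rewrite mulr0 addr0; apply.
have /ooU := approx_flow_dist x; apply: filterS2 UP => k Pk vk; apply: vk => //.
move=> tau tau0 taus; rewrite distrC.
apply: (PQ (k, tau)); split => //=.
apply: WQ => /=; last by split => //; rewrite ltry.
by rewrite distrC (le_lt_trans taus)// distrC.
Qed.

End Limit.
End ApproximateFlows.

(** * Regularity of solutions and Peano's theorem *)

Section Flows.
Context {R : realType} {I : Type}.
Implicit Types (F : I -> (I -> R) -> R) (u : I -> R -> R).

Local Notation halfline := (time_interval (+oo : \bar R)).

Lemma has_deriv_within_is_derive (f : R -> R) (t l : R) : 0 < t ->
  has_deriv_within halfline f t l -> is_derive t 1 f l.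
Proof.
move=> t0 fl.
suff : h^-1 *: ((f \o shift t) (h *: 1) - f t) @[h --> 0^'] --> l.
  by move=> dq; apply: DeriveDef; [apply/cvg_ex; exists l|exact/cvg_lim].
apply/cvgrPdist_le => eps eps0.
have /cvgrPdist_le/(_ _ eps0)[d /= d0 fd] := fl.
exists (Num.min d t) => /=; first by rewrite lt_min d0.
move=> h /=; rewrite sub0r normrN lt_min => /andP[hd ht] h0.
have := fd (h + t); rewrite /ball_/= opprD addrCA subrr addr0 normrN => /(_ hd).
have ht0 : h + t != t by rewrite -subr_eq0 addrK.
move=> /(_ ht0); rewrite [h + t - t]addrK /= [h *: 1]mulr1 mulrC; apply.
split; last by rewrite ltry.
by move: ht; rewrite ltr_norml => /andP[]; lra.
Qed.

Lemma has_deriv_within_cvg (f : R -> R) (t l : R) :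
  has_deriv_within halfline f t l -> f s @[s --> within halfline (nbhs t)] --> f t.
Proof.
move=> fl; apply/cvgrPdist_le => eps eps0.
have /cvgrPdist_le/(_ _ (@ltr01 R))[d /= d0 fd] := fl.
have l1 : 0 < `|l| + 1 by rewrite ltr_wpDl.
exists (Num.min d (eps / (`|l| + 1))); first by rewrite /= lt_min d0 divr_gt0.
move=> s /=; rewrite lt_min => /andP[sd se] sI.
have [->|st] := eqVneq s t; first by rewrite subrr normr0 ltW.
have := fd s sd st sI.
have st0 : s - t != 0 by rewrite subr_eq0.
set q := (f s - f t) / (s - t) => ql.
have -> : f t - f s = q * (t - s) by rewrite /q; field.
rewrite normrM (le_trans (_ : _ <= (`|l| + 1) * `|t - s|))//.
  rewrite ler_wpM2r// -[q](subrK l) addrC (le_trans (ler_normD _ _))//.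
  by rewrite lerD2l distrC.
by rewrite mulrC -ler_pdivlMr// ltW.
Qed.

Section Regularity.
Variables (F : I -> (I -> R) -> R) (u : I -> R -> R).
Hypothesis uF : flow F u.

Lemma flow_cvg x (t : R) : 0 <= t ->
  u x s @[s --> within halfline (nbhs t)] --> u x t.
Proof. by move=> t0; apply: has_deriv_within_cvg; exact: uF. Qed.

Lemma flow_continuous x : {within halfline, continuous (u x)}.
Proof. by apply/subspace_continuousP => t [t0 _]; exact: flow_cvg. Qed.

Lemma flow_is_derive x (t : R) : 0 < t -> is_derive t 1 (u x) (F x (u ^~ t)).
Proof.
by move=> t0; apply: has_deriv_within_is_derive => //; exact/uF/ltW.
Qed.

Lemma flow_C1 x : ptws_continuous (F x) -> C1_on halfline (u x).
Proof.
move=> cF; exists (fun t => F x (u ^~ t)) => [|t [t0 _]]; last exact: uF.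
apply/subspace_continuousP => t [t0 _].
by apply: cF => y; exact: flow_cvg.
Qed.

Lemma flow_MVT x s t : 0 <= s -> s <= t ->
  exists2 tau, s <= tau <= t & u x t - u x s = F x (u ^~ tau) * (t - s).
Proof.
move=> s0 st; have [||tau] := @MVT_segment R (u x) (fun t => F x (u ^~ t)) s t st.
- move=> r; rewrite in_itv/= => /andP[sr _].
  by apply: flow_is_derive; exact: le_lt_trans sr.
- apply: continuous_subspaceW (@flow_continuous x) => r /=.
  by rewrite in_itv/= => /andP[sr _]; split; [exact: le_trans sr|rewrite ltry].
by rewrite in_itv/=; exists tau.
Qed.

Lemma flow_stationary x t : (forall f, F x f = 0) -> 0 <= t -> u x t = u x 0.
Proof.
move=> F0 t0; have [tau _] := flow_MVT x (lexx 0) t0.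
by rewrite F0 mul0r => /eqP; rewrite subr_eq0 => /eqP.
Qed.

End Regularity.

Section Peano.
Variables (F : I -> (I -> R) -> R) (M : R).
Hypothesis (cF : forall x, ptws_continuous (F x)).
Hypothesis (bF : forall x f, `|F x f| <= M).

Definition euler (f : I -> R) (h : R) (n : nat) : I -> R :=
  iter n (fun g x => g x + h * F x g) f.

(** As long as the velocity stays within eps of c, each step of length h moves
    [x] by h c up to h eps. *)
Lemma euler_drift f h x c eps m n : 0 <= h ->
  (forall l, (l < n)%N -> `|F x (euler f h (m + l)) - c| <= eps) ->
  `|euler f h (m + n) x - euler f h m x - n%:R * h * c| <= eps * (n%:R * h).
Proof.
move=> h0; elim: n => [|n IH] Fc.
  by rewrite addn0 subrr !mul0r mulr0 subrr normr0.
have -> : euler f h (m + n.+1) x - euler f h m x - n.+1%:R * h * c =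
   (euler f h (m + n) x - euler f h m x - n%:R * h * c)
   + h * (F x (euler f h (m + n)) - c).
  by rewrite addnS /= -natr1; ring.
rewrite (le_trans (ler_normD _ _))// -natr1.
have -> : eps * ((n%:R + 1) * h) = eps * (n%:R * h) + h * eps by ring.
rewrite lerD//; first by apply: IH => l ln; apply: Fc; exact: ltnW.
by rewrite normrM ger0_norm// ler_wpM2l// Fc.
Qed.

(* The approximate solutions are step functions: the discrete values are held
   constant between grid points, which costs one step in [approx_flow]. *)
Let h (k : nat) : R := k.+1%:R^-1.
Let v (f : I -> R) k x t := euler f (h k) (Num.truncn (t / h k)) x.

Let h_gt0 k : 0 < h k. Proof. by rewrite invr_gt0. Qed.

Lemma euler_approx_flow f : approx_flow F (v f) h.
Proof.
move=> x; apply: filterE => k s t c eps s0 st Fc.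
have t0 : 0 <= t by exact: le_trans st.
have hk := h_gt0 k; rewrite /v.
have sh0 : 0 <= s / h k by rewrite divr_ge0// ltW.
have th0 : 0 <= t / h k by rewrite divr_ge0// ltW.
have /andP[s1 s2] := truncn_itv sh0; have /andP[t1 t2] := truncn_itv th0.
move: s1 s2 t1 t2; rewrite ler_pdivlMr// ltr_pdivrMr// ler_pdivlMr// ltr_pdivrMr//.
set i := Num.truncn (s / h k); set j := Num.truncn (t / h k) => s1 s2 t1 t2.
have ij : (i <= j)%N by apply: le_truncn; rewrite ler_pM2r// invr_gt0.
have eps0 : 0 <= eps.
  by apply: le_trans (Fc s _) => //; rewrite lexx.
have drift : `|euler f (h k) (i + (j - i)) x - euler f (h k) i x
    - (j - i)%:R * h k * c| <= eps * ((j - i)%:R * h k).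
  apply: euler_drift; first exact: ltW.
  (* The first step starts at the grid point before s, where the step function
     has its value at time s; the others start at grid points of [s, t]. *)
  move=> [|l] lij.
    by rewrite addn0; apply: (Fc s); rewrite lexx.
  have il : Num.truncn ((i + l.+1)%:R * h k / h k) = (i + l.+1)%N.
    by rewrite mulfK ?gt_eqF// natrK.
  have := Fc ((i + l.+1)%:R * h k); rewrite /v il; apply; apply/andP; split.
    apply: ltW (lt_le_trans s2 _).
    by rewrite ler_pM2r// ler_nat addnS ltnS leq_addr.
  apply: le_trans t1; rewrite ler_pM2r// ler_nat; lia.
move: drift; rewrite subnKC// natrB//.
set X := euler _ _ _ _ - _ => drift.
set n : R := j%:R - i%:R in drift *.
have nts : `|n * h k - (t - s)| <= h k.
  rewrite ler_norml /n; apply/andP; rewrite -!natr1 in s2 t2.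
  by split; nra.
have -> : X - (t - s) * c = (X - n * h k * c) + (n * h k - (t - s)) * c by ring.
rewrite (le_trans (ler_normD _ _))// normrM.
have h1 : `|n * h k - (t - s)| * `|c| <= h k * `|c| by rewrite ler_wpM2r.
have h2 : eps * (n * h k) <= eps * (t - s + h k).
  rewrite ler_wpM2l//; move: nts; rewrite ler_norml => /andP[_]; lra.
have -> : eps * (t - s) + (`|c| + eps) * h k = eps * (t - s + h k) + h k * `|c|.
  by ring.
by rewrite lerD// (le_trans drift).
Qed.

Lemma euler_bounded f x t : exists C : R, forall k, `|v f k x t| <= C.
Proof.
exists (`|f x| + M * `|t|) => k; rewrite /v.
have hk := h_gt0 k.
set n := Num.truncn (t / h k).
have nt : n%:R * h k <= `|t|.
  have [t0|t0] := leP 0 t.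
    by rewrite ger0_norm// -ler_pdivlMr// truncn_le// divr_ge0// ltW.
  suff -> : n = 0%N by rewrite mul0r.
  apply/truncn0Pn; rewrite -ltNge (@lt_trans _ _ 0)//.
  by rewrite pmulr_llt0// invr_gt0.
have := @euler_drift f (h k) x 0 M 0 n (ltW hk).
rewrite mulr0 subr0 add0n /=.
have Fb l : (l < n)%N -> `|F x (euler f (h k) (0 + l)) - 0| <= M.
  by rewrite subr0 bF.
move=> /(_ Fb) drift; have M0 : 0 <= M by apply: le_trans (bF x f).
rewrite -[euler _ _ _ _](subrK (f x)) addrC (le_trans (ler_normD _ _))// lerD2l.
by rewrite (le_trans drift)// ler_wpM2l.
Qed.

(** Global existence for a bounded continuous vector field, in possibly infinitely
    many unknowns.  Compactness selects one solution; there may be others. *)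
Lemma peano_existence (f : I -> R) :
  exists u, flow F u /\ forall x, u x 0 = f x.
Proof.
have [U [UU ooU]] := eventually_ultrafilter.
have [a va] := @ultrafilter_pointwise_limit R (I * R) U
  (fun k xt => v f k xt.1 xt.2) UU (fun xt => euler_bounded f xt.1 xt.2).
exists (fun x t => a (x, t)); split.
  apply: (flow_limit bF (euler_approx_flow f) cF (@cvg_harmonic R) ooU).
  by move=> x t _; exact: (va (x, t)).
move=> x; have v0 : v f k x 0 @[k --> U] --> f x.
  by rewrite /v; under eq_fun do rewrite mul0r truncn0; exact: cvg_cst.
exact: (cvg_unique _ (va (x, 0)) v0).
Qed.

End Peano.
End Flows.

(** * Extraction of a subsequence *)

Section Subsequence.
Context {R : realType} {I : countType}.
Variables (v : nat -> I -> R -> R) (u : I -> R -> R) (e : nat -> R) (M : R).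
Variables (U : set_system nat).
Hypothesis (PU : ProperFilter U) (ooU : \oo `<=` U).
Hypothesis (e0 : e k @[k --> \oo] --> (0 : R)).
Hypothesis (vu : forall x (t : R), 0 <= t -> v k x t @[k --> U] --> u x t).
Hypothesis (vL : forall x, \forall k \near \oo, forall s t,
  0 <= s -> 0 <= t -> `|v k x t - v k x s| <= M * `|t - s| + M * e k).
Hypothesis (uL : forall x s t,
  0 <= s -> 0 <= t -> `|u x t - u x s| <= M * `|t - s|).

Let pairs m : seq (I * rat) := pmap unpickle (iota 0 m).

Let good m k := forall xr, xr \in pairs m -> 0 <= ratr xr.2 :> R ->
  `|u xr.1 (ratr xr.2) - v k xr.1 (ratr xr.2)| <= m.+1%:R^-1.

Let near_good m : \forall k \near U, good m k.
Proof.
rewrite /good; elim: (pairs m) => [|xr s IH].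
  by apply: filterE.
have near_xr : \forall k \near U, 0 <= ratr xr.2 :> R ->
    `|u xr.1 (ratr xr.2) - v k xr.1 (ratr xr.2)| <= m.+1%:R^-1.
  have [r0|r0] := leP 0 (ratr xr.2 : R); last by apply: filterE.
  have /cvgrPdist_le/(_ m.+1%:R^-1) := @vu xr.1 _ r0.
  by rewrite invr_gt0 ltr0Sn => /(_ isT); apply: filterS.
apply: filterS2 near_xr IH => k kxr ks yr.
by rewrite inE => /predU1P[->//|]; exact: ks.
Qed.

(** Along [U] the convergence at finitely many pairs holds simultaneously, so
    [phi] can be built recursively with [phi m] handling the first [m] pairs
    (vertex, rational time) up to 1/(m+1).  The Lipschitz bounds carry the
    convergence from rational to real times. *)
Lemma pointwise_subsequence : exists phi : nat -> nat,
  [/\ forall k, (1 <= phi k)%N, forall k, (phi k < phi k.+1)%N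
    & forall x (t : R), 0 <= t -> v (phi k) x t @[k --> \oo] --> u x t].
Proof.
have pick m N : exists k, (N <= k)%N /\ good m k.
  have NU : U [set k | (N <= k)%N] by apply: ooU; exists N.
  have [k [Nk gk]] := filter_ex (filterI NU (near_good m)).
  by exists k.
have /choice[g gP] : forall mN : nat * nat, exists k, (mN.2 <= k)%N /\ good mN.1 k.
  by move=> [m N]; exact: pick.
pose phi := fix phi m := if m is m'.+1 then g (m, (phi m').+1) else g (0%N, 1%N).
have phi_good m : good m (phi m) by case: m => [|m] /=; exact: (gP (_, _)).2.
have phi_lt m : (phi m < phi m.+1)%N by exact: (gP (m.+1, (phi m).+1)).1.
have phi_ge m : (m.+1 <= phi m)%N.
  elim: m => [|m IH]; first exact: (gP (0%N, 1%N)).1.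
  exact: leq_ltn_trans IH (phi_lt m).
have phi_oo : phi m @[m --> \oo] --> \oo.
  move=> A [N _ NA]; exists N => // m /= Nm; apply: NA => /=.
  by rewrite (leq_trans Nm)// ltnW.
exists phi; split => [k||x t t0]; [exact: leq_trans (phi_ge k)|exact: phi_lt|].
apply/cvgrPdist_le => eps eps0.
have eps4 : 0 < eps / 4 by rewrite divr_gt0.
have M1 : 0 < `|M| + 1 by rewrite ltr_wpDl.
(* A rational time on the right of t is automatically nonnegative. *)
have td : t < t + eps / 4 / (`|M| + 1) by rewrite ltrDl divr_gt0.
have [rho] := rat_in_itvoo td.
rewrite in_itv/= => /andP[trho rhod].
have rho0 : 0 <= ratr rho :> R by apply: le_trans (ltW trho).
have Mrho : M * `|ratr rho - t| <= eps / 4.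
  rewrite (@le_trans _ _ ((`|M| + 1) * `|ratr rho - t|))//.
    by rewrite ler_wpM2r// (le_trans (ler_norm _))// lerDl.
  by rewrite mulrC -ler_pdivlMr// ger0_norm; [lra|rewrite subr_ge0 ltW].
have near_L := phi_oo _ (@vL x).
have near_e : \forall m \near \oo, `|0 - M * e (phi m)| <= eps / 4.
  have : M * e (phi m) @[m --> \oo] --> (0 : R).
    rewrite -(mulr0 M); apply: cvgM; first exact: cvg_cst.
    exact: cvg_comp phi_oo e0.
  by move/cvgrPdist_le; exact.
have near_h : \forall m \near \oo, `|0 - (m.+1%:R^-1 : R)| <= eps / 4.
  by have /cvgrPdist_le := @cvg_harmonic R; exact.
have near_p : \forall m \near \oo, (pickle (x, rho) < m)%N.
  by exists (pickle (x, rho)).+1.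
near=> m.
have Lm : forall s t, 0 <= s -> 0 <= t ->
    `|v (phi m) x t - v (phi m) x s| <= M * `|t - s| + M * e (phi m).
  by near: m.
have em : `|0 - M * e (phi m)| <= eps / 4 by near: m.
have hm : `|0 - (m.+1%:R^-1 : R)| <= eps / 4 by near: m.
have pm : (pickle (x, rho) < m)%N by near: m.
have gm : `|u x (ratr rho) - v (phi m) x (ratr rho)| <= m.+1%:R^-1.
  apply: (phi_good m (x, rho)) => //.
  rewrite mem_pmap; apply/mapP; exists (pickle (x, rho)); last by rewrite pickleK.
  by rewrite mem_iota.
have := Lm _ _ t0 rho0; have := @uL x _ _ t0 rho0.
move: em hm gm Mrho; rewrite !sub0r !normrN.
move: (M * `|_|) (M * e _) (m.+1%:R^-1 : R) => a b c.
move: (u x t) (u x (ratr rho)) (v _ x t) (v _ x (ratr rho)) => ut ur vt vr.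
rewrite !ler_norml.
move=> /andP[? ?] /andP[? ?] /andP[? ?] ? /andP[? ?] /andP[? ?].
by apply/andP; split; lra.
Unshelve. all: by end_near. Qed.

End Subsequence.

(** * Weighted graphs and the p-Laplacian *)

Section WeightedGraphs.
Context {R : realType} {V : countType}.
Variables (w : V -> V -> R).
Hypothesis (wg : weighted_graph w).
Implicit Types (x y : V) (f g : V -> R) (D : seq V) (B : set V).

Definition nbhd x : seq V := finmap.enum_fset (fset_set [set y | adj w x y]).

Lemma mem_nbhd x y : (y \in nbhd x) = adj w x y.
Proof.
rewrite /nbhd in_fset_set; last exact: wg_locfin.
by apply/idP/idP; rewrite inE.
Qed.

Lemma nbhd_uniq x : uniq (nbhd x).
Proof. exact: finmap.fset_uniq. Qed.

Lemma weight_off_nbhd D x y : {subset nbhd x <= D} -> y \notin D -> w x y = 0.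
Proof.
move=> sD yD; apply/eqP; rewrite eq_le wg_ge0// andbT leNgt.
by apply: contra yD => wxy; rewrite sD// mem_nbhd.
Qed.

Lemma vmeasE x : vmeas w x = \sum_(y <- nbhd x) w x y.
Proof. by rewrite /vmeas fsbig_finite//; exact: wg_locfin. Qed.

Lemma vmeas_gt0 x : 0 < vmeas w x.
Proof.
apply: lt_le_trans (wg_mu0 wg) _; apply: ge_inf; last by exists x.
by exists 0 => _ [y _ <-]; rewrite vmeasE sumr_ge0// => z _; exact: wg_ge0.
Qed.

Lemma vmeas_ge_inf x : inf (range (vmeas w)) <= vmeas w x.
Proof.
apply: ge_inf; last by exists x.
by exists 0 => _ [y _ <-]; exact/ltW/vmeas_gt0.
Qed.

(** Summing over any finite set containing the neighbourhood allows one common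
    range for all vertices, as required to exchange the sums in
    [dissipation]. *)
Lemma plaplaceE p f x D : uniq D -> {subset nbhd x <= D} ->
  plaplace w p f x =
  (vmeas w x)^-1 * \sum_(y <- D) spow (f y - f x) (p - 1) * w x y.
Proof.
move=> uD sD; rewrite /plaplace (fsbigE D)//.
  congr (_ * _); under eq_bigl do rewrite in_setT.
  apply: eq_bigr => y _; rewrite /spow.
  by have -> : p - 1 - 1 = p - 2 by ring.
by move=> y _ yD; rewrite (weight_off_nbhd sD yD) mulr0.
Qed.

Lemma plaplace_bound p f x (C : R) : 1 < p -> (forall y, `|f y| <= C) ->
  `|plaplace w p f x| <= (C + C) `^ (p - 1).
Proof.
move=> p1 fC; have p0 : 0 < p - 1 by rewrite subr_gt0.
have mx := vmeas_gt0 x.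
rewrite (plaplaceE _ _ (nbhd_uniq x) (fun _ => id)) normrM normfV (gtr0_norm mx).
rewrite mulrC ler_pdivrMr// [in leRHS]vmeasE mulr_sumr.
rewrite (le_trans (ler_norm_sum _ _ _))// ler_sum// => y _.
rewrite normrM norm_spow// (ger0_norm (wg_ge0 wg _ _)) ler_wpM2r ?wg_ge0//.
have fxy : `|f y - f x| <= C + C by rewrite (le_trans (ler_normB _ _))// lerD.
apply: ge0_ler_powR; rewrite ?nnegrE//; first exact: ltW.
exact: le_trans fxy.
Qed.

Lemma plaplace_continuous p (Q : R -> R) x : 1 < p -> continuous Q ->
  ptws_continuous (fun f : V -> R => plaplace w p (fun y => Q (f y)) x).
Proof.
move=> p1 cQ T U g f FU gf.
have Qgf y : Q (g k y) @[k --> U] --> Q (f y).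
  exact: (cvg_comp _ _ (gf y) (cQ (f y))).
rewrite (plaplaceE _ _ (nbhd_uniq x) (fun _ => id)).
under eq_fun do rewrite (plaplaceE _ _ (nbhd_uniq x) (fun _ => id)).
apply: cvgM; first exact: cvg_cst.
elim: (nbhd x) => [|y D IH].
  by rewrite big_nil; under eq_fun do rewrite big_nil; exact: cvg_cst.
rewrite big_cons; under eq_fun do rewrite big_cons.
apply: cvgD IH; apply: cvgM; last exact: cvg_cst.
have p0 : 0 < p - 1 by rewrite subr_gt0.
apply: (cvg_comp (fun k => Q (g k y) - Q (g k x)) (fun s : R => spow s (p - 1))).
  by apply: cvgB; exact: Qgf.
exact: spow_continuous.
Qed.

Lemma walkS n x y : walk w n.+1 x y -> exists2 z, adj w x z & walk w n z y.
Proof.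
move=> [[|z s] [//= /andP[xz zs] <- [sn]]].
by exists z => //; exists s.
Qed.

(** The starting points of walks of length n + 1 are neighbours of the starting
    points of walks of length n. *)
Lemma finite_walk n y : finite_set [set x | walk w n x y].
Proof.
elim: n => [|n IH].
  apply: (@sub_finite_set _ _ [set y]); last exact: finite_set1.
  by move=> x [[|z s] [_ /= xy]].
apply: (@sub_finite_set _ _
    (\bigcup_(z in [set z | walk w n z y]) [set x | adj w z x])).
  by move=> x /walkS[z xz zy]; exists z => //=; rewrite /adj wg_sym.
by apply: bigcup_finite => // z _; exact: wg_locfin.
Qed.

Lemma walk_gdist x y : walk w (gdist w x y) x y.
Proof.
rewrite /gdist; case: xgetP => [n _ []//|nP].
have [n xy] := wg_connected wg x y.
pose P m := `[< walk w m x y >].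
have exP : exists m, P m by exists n; apply/asboolP.
case: (ex_minnP exP) => m /asboolP mxy mmin.
by case: (nP m); split => // k kxy; apply: mmin; apply/asboolP.
Qed.

Lemma finite_gball x0 n : finite_set (gball w x0 n).
Proof.
apply: (@sub_finite_set _ _ (\bigcup_(m in `I_n.+1) [set x | walk w m x x0])).
  by move=> x xn; exists (gdist w x x0) => //; exact: walk_gdist.
by apply: bigcup_finite => // m _; exact: finite_walk.
Qed.

Lemma gball_near x0 x : \forall n \near \oo, gball w x0 n x.
Proof. by exists (gdist w x x0). Qed.

Lemma finite_closed_nbhd B : finite_set B ->
  exists2 D, uniq D & forall x, B x -> {subset nbhd x <= D}.
Proof.
move=> finB; pose E : seq V := finmap.enum_fset (fset_set B).
exists (undup (flatten [seq nbhd x | x <- E])); first exact: undup_uniq.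
move=> x Bx y yx; rewrite mem_undup; apply/flattenP; exists (nbhd x) => //.
by apply: map_f; rewrite in_fset_set// mem_set.
Qed.

(** Summation by parts: exchanging the roles of x and y in the double sum
    changes the sign of the difference a(y) - a(x), so twice the sum is the
    double sum of (b(x) - b(y)) |a(y) - a(x)|^(p-2) (a(y) - a(x)) w(x, y), whose
    terms are nonpositive. *)
Lemma dissipation p (a b : V -> R) D :
  (forall x y, 0 <= (b y - b x) * (a y - a x)) ->
  \sum_(x <- D) b x * (\sum_(y <- D) spow (a y - a x) (p - 1) * w x y) <= 0.
Proof.
move=> ab; set S := (X in X <= _).
have S1 : S = \sum_(x <- D) \sum_(y <- D) b x * (spow (a y - a x) (p - 1) * w x y).
  by apply: eq_bigr => x _; rewrite mulr_sumr.
have S2 : S =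
    \sum_(x <- D) \sum_(y <- D) - (b y * (spow (a y - a x) (p - 1) * w x y)).
  rewrite S1 exchange_big/=; apply: eq_bigr => x _; apply: eq_bigr => y _.
  by rewrite -(opprB (a y)) spowN (wg_sym wg y x); ring.
have : S + S <= 0.
  rewrite {1}S1 S2 -big_split/= sumr_le0// => x _.
  rewrite -big_split/= sumr_le0// => y _.
  have -> : b x * (spow (a y - a x) (p - 1) * w x y) +
      - (b y * (spow (a y - a x) (p - 1) * w x y)) =
      - (`|a y - a x| `^ (p - 1 - 1) * w x y * ((b y - b x) * (a y - a x))).
    by rewrite /spow; ring.
  by rewrite oppr_le0 mulr_ge0// mulr_ge0 ?powR_ge0 ?wg_ge0.
lra.
Qed.

End WeightedGraphs.

(** * Energy decay on a finite set *)

Section Energy.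
Context {R : realType} {V : countType}.
Variables (w : V -> V -> R) (p : R) (Q : R -> R).
Hypothesis (wg : weighted_graph w).

Local Notation halfline := (time_interval (+oo : \bar R)).

(** The vector field of the Dirichlet problem on [B]: it vanishes outside [B], so
    that zero boundary values are preserved by the evolution. *)
Definition laplace_on (B : set V) (x : V) (f : V -> R) : R :=
  if x \in B then plaplace w p (fun y => Q (f y)) x else 0.

Lemma laplace_on_out B x f : ~ B x -> laplace_on B x f = 0.
Proof. by move=> nBx; rewrite /laplace_on memNset. Qed.

Lemma laplace_on_in B x f : B x ->
  laplace_on B x f = plaplace w p (fun y => Q (f y)) x.
Proof. by move=> Bx; rewrite /laplace_on mem_set. Qed.

Lemma laplace_on_continuous B x : 1 < p -> continuous Q ->
  ptws_continuous (laplace_on B x).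
Proof.
move=> p1 cQ T U g f FU gf; rewrite /laplace_on; case: ifP => _.
  exact: plaplace_continuous.
exact: cvg_cst.
Qed.

Lemma laplace_on_bound B x f (C : R) : 1 < p -> (forall s, `|Q s| <= C) ->
  `|laplace_on B x f| <= (C + C) `^ (p - 1).
Proof.
move=> p1 QC; rewrite /laplace_on; case: ifP => _.
  exact: plaplace_bound.
by rewrite normr0 powR_ge0.
Qed.

Hypothesis (mQ : {homo Q : s t / s <= t}).
Variables (r : R) (B : set V) (D : seq V).
Hypothesis (r1 : 1 < r) (uD : uniq D).
Hypothesis (nbhdD : forall x, B x -> {subset nbhd w x <= D}).
Variable (u : V -> R -> R).
Hypothesis (uF : flow (laplace_on B) u) (u0 : forall x, ~ B x -> u x 0 = 0).

Lemma flow_on_out x t : ~ B x -> 0 <= t -> u x t = 0.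
Proof.
move=> nBx t0.
by rewrite (flow_stationary uF (fun f => laplace_on_out f nBx) t0) u0.
Qed.

(* The sums run over D, which contains the neighbours of the vertices of B, so that
   [dissipation] accounts for the edges leaving B; the equation is only used inside B, because
   spow (u x t) (r - 1) vanishes at the vertices of D outside B. *)
Let energy t := \sum_(x <- D) `|u x t| `^ r * vmeas w x.
Let denergy t :=
  \sum_(x <- D) r * spow (u x t) (r - 1) * laplace_on B x (u ^~ t) * vmeas w x.

Let energy_is_derive (t : R) : 0 < t -> is_derive t 1 energy (denergy t).
Proof.
move=> t0; have term x : is_derive t 1 (fun s => `|u x s| `^ r * vmeas w x)
    (r * spow (u x t) (r - 1) * laplace_on B x (u ^~ t) * vmeas w x).
  have dn := is_derive_normr_powR (u x t) r1.
  have du := flow_is_derive uF x t0.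
  have dc := @is_derive1_comp R _ _ _ _ _ dn du.
  have := is_deriveZ (vmeas w x) dc.
  rewrite [vmeas w x *: _]mulrC.
  have -> // : vmeas w x \*: ((fun h : R => `|h| `^ r) \o u x) =
    (fun s => `|u x s| `^ r * vmeas w x).
  by apply/funext => s /=; rewrite mulrC.
rewrite /energy /denergy; elim: D => [|x E IH].
  rewrite big_nil; under eq_fun do rewrite big_nil.
  exact: is_derive_cst.
rewrite big_cons; under eq_fun do rewrite big_cons.
by have := is_deriveD (term x) IH.
Qed.

Let energy_continuous : {within halfline, continuous energy}.
Proof.
apply/subspace_continuousP => t [t0 _].
suff : energy s @[s --> within halfline (nbhs t)] --> energy t by [].
rewrite /energy; elim: D => [|x E IH].
  by rewrite big_nil; under eq_fun do rewrite big_nil; exact: cvg_cst.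
rewrite big_cons; under eq_fun do rewrite big_cons.
apply: cvgD IH; apply: cvgM; last exact: cvg_cst.
apply: (cvg_comp (u x) (fun h => `|h| `^ r) (flow_cvg uF t0)).
have [+ _] := is_derive_normr_powR (u x t) r1.
by move=> /derivable1_diffP/differentiable_continuous.
Qed.

Let denergy_le0 t : 0 <= t -> denergy t <= 0.
Proof.
move=> t0.
have -> : denergy t = r * \sum_(x <- D) spow (u x t) (r - 1) *
    (\sum_(y <- D) spow (Q (u y t) - Q (u x t)) (p - 1) * w x y).
  rewrite mulr_sumr; apply: eq_bigr => x _.
  have [Bx|nBx] := pselect (B x); last first.
    by rewrite flow_on_out// /spow !(mulr0, mul0r).
  rewrite laplace_on_in// (plaplaceE wg _ _ uD (nbhdD Bx)).
  by have := vmeas_gt0 wg x => mx; field; rewrite gt_eqF.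
apply: mulr_ge0_le0; first by rewrite ltW// (lt_trans _ r1).
apply: dissipation => // x y.
have rr : 0 < r - 1 by rewrite subr_gt0.
have [xy|/ltW yx] := leP (u x t) (u y t).
  by rewrite mulr_ge0// subr_ge0 ?spow_le// mQ.
by rewrite mulr_le0// subr_le0 ?spow_le// mQ.
Qed.

(** By the mean value theorem and [dissipation], since u^(r-1) and Q(u) are both
    nondecreasing functions of u. *)
Lemma energy_nonincreasing t : 0 <= t ->
  \sum_(x <- D) `|u x t| `^ r * vmeas w x <=
  \sum_(x <- D) `|u x 0| `^ r * vmeas w x.
Proof.
move=> t0; have [||c] := @MVT_segment R energy denergy 0 t t0.
- by move=> s; rewrite in_itv/= => /andP[s0 _]; exact: energy_is_derive.
- apply: continuous_subspaceW energy_continuous => s /=.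
  by rewrite in_itv/= => /andP[s0 _]; split => //; rewrite ltry.
rewrite in_itv/= subr0 => /andP[c0 _] Ec.
by rewrite -subr_le0 [X in X <= _]Ec mulr_le0_ge0// denergy_le0.
Qed.

End Energy.

(** * Finite sums and the norm of l^r *)

Section Lspace.
Context {R : realType} {V : countType}.
Variables (w : V -> V -> R).
Hypothesis (wg : weighted_graph w).

(** The condition that the r-th power of the norm is at most [N], in terms of
    finite sums only: it passes directly to pointwise limits. *)
Definition sums_le (r N : R) (f : V -> R) : Prop :=
  forall D : seq V, uniq D -> \sum_(x <- D) `|f x| `^ r * vmeas w x <= N.

Let term_ge0 r (f : V -> R) x : 0 <= `|f x| `^ r * vmeas w x.
Proof. by rewrite mulr_ge0 ?powR_ge0// ltW// vmeas_gt0. Qed.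

Lemma lspace_sums_le r f : 0 < r -> lspace w r f -> exists N, sums_le r N f.
Proof.
move=> r0 fr.
have Ioo : (\esum_(x in [set: V]) (`|f x| `^ r * vmeas w x)%:E < +oo)%E.
  by apply: lty_poweRy fr; rewrite invr_eq0 gt_eqF.
have I0 : (0 <= \esum_(x in [set: V]) (`|f x| `^ r * vmeas w x)%:E)%E.
  by apply: esum_ge0 => x _; rewrite lee_fin.
exists (fine (\esum_(x in [set: V]) (`|f x| `^ r * vmeas w x)%:E)) => D uD.
rewrite -lee_fin fineK ?ge0_fin_numE// -sumEFin; apply: esum_ge.
by exists [set` D]; [split => //; exact: finite_seq|rewrite fsbig_seq].
Qed.

Lemma sums_le_lnorm r N f : 0 < r -> sums_le r N f ->
  (lnorm w r f <= (N `^ r^-1)%:E)%E.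
Proof.
move=> r0 fN; have N0 : 0 <= N by have := fN [::] isT; rewrite big_nil.
have I0 : (0 <= \esum_(x in [set: V]) (`|f x| `^ r * vmeas w x)%:E)%E.
  by apply: esum_ge0 => x _; rewrite lee_fin.
rewrite -poweR_EFin; apply: gt0_ler_poweR.
- by rewrite invr_ge0 ltW.
- by rewrite in_itv/= I0 leey.
- by rewrite in_itv/= lee_fin N0 leey.
apply: ge_ereal_sup => _ [A [finA _] <-].
rewrite fsbig_finite// sumEFin lee_fin; apply: fN.
exact: finmap.fset_uniq.
Qed.

Lemma sum_sub_le (D E : seq V) (F : V -> R) : uniq D -> uniq E ->
  {subset D <= E} -> (forall x, 0 <= F x) ->
  \sum_(x <- D) F x <= \sum_(x <- E) F x.
Proof.
move=> uD uE DE F0; have pD : perm_eq D [seq x <- E | x \in D].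
  apply: uniq_perm => //; first exact: filter_uniq.
  move=> x; rewrite mem_filter; apply/idP/andP => [xD|[]//].
  by split => //; exact: DE.
rewrite (perm_big _ pD)/= big_filter [leRHS](bigID (mem D))/= lerDl.
exact: sumr_ge0.
Qed.

End Lspace.

(** * Truncated powers *)

Section Clamp.
Context {R : realType}.
Implicit Types (K s t : R).

Definition clamp K s := Num.max (- K) (Num.min K s).

Lemma clamp_le K s t : s <= t -> clamp K s <= clamp K t.
Proof.
move=> st; rewrite /clamp /Order.max /Order.min.
by do !case: ifPn; rewrite -?leNgt => *; lra.
Qed.

Lemma clamp_id K s : `|s| <= K -> clamp K s = s.
Proof.
by rewrite ler_norml => /andP[Ks sK]; rewrite /clamp (min_r sK) (max_r Ks).
Qed.

Lemma norm_clamp K s : 0 <= K -> `|clamp K s| <= K.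
Proof.
move=> K0; rewrite ler_norml /clamp le_max lexx/= ge_max ge_min lexx andbT.
by rewrite (le_trans _ K0)// oppr_le0.
Qed.

Lemma clamp_lipschitz K s t : `|clamp K s - clamp K t| <= `|s - t|.
Proof.
wlog st : s t / s <= t.
  have [st|/ltW ts] := leP s t => [|/(_ _ _ ts)]; first exact.
  by rewrite distrC (distrC t).
rewrite distrC (distrC s) !ger0_norm ?subr_ge0 ?clamp_le//.
by rewrite /clamp /Order.max /Order.min; do !case: ifPn;
  rewrite -?leNgt => *; lra.
Qed.

Lemma clamp_continuous K : continuous (clamp K).
Proof.
move=> s; apply/cvgrPdist_le => eps eps0; exists eps => // t /= /ltW st.
exact: le_trans (clamp_lipschitz K s t) st.
Qed.

Definition cpow K q s := spow (clamp K s) q.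

Lemma cpow_le K q : 0 < q -> {homo cpow K q : s t / s <= t}.
Proof. by move=> q0 s t st; rewrite spow_le// clamp_le. Qed.

Lemma cpow_continuous K q : 0 < q -> continuous (cpow K q).
Proof.
move=> q0 s; apply: (@continuous_comp _ _ _ (clamp K) (fun k => spow k q)).
  exact: clamp_continuous.
exact: spow_continuous.
Qed.

Lemma cpow_bound K q s : 0 < q -> 0 <= K -> `|cpow K q s| <= K `^ q.
Proof.
move=> q0 K0; rewrite norm_spow//.
by apply: ge0_ler_powR; rewrite ?nnegrE ?norm_clamp// ltW.
Qed.

End Clamp.

(** * Exhaustion solutions *)

Section Exhaustion.
Context {R : realType} {V : countType}.
Variables (w : V -> V -> R) (x0 : V) (p q r N : R) (u0 : V -> R).
Hypothesis (wg : weighted_graph w) (p1 : 1 < p) (q0 : 0 < q) (r1 : 1 < r).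
Hypothesis (u0N : sums_le w r N u0).

Let r0 : 0 < r. Proof. exact: lt_trans r1. Qed.

Let mu0 := inf (range (vmeas w)).
Let K := (N / mu0) `^ r^-1.
Let Q := cpow K q.
Let C := K `^ q.

Let N0 : 0 <= N. Proof. by have := u0N (D := [::]) isT; rewrite big_nil. Qed.

Let K0 : 0 <= K. Proof. exact: powR_ge0. Qed.

Let QC s : `|Q s| <= C. Proof. exact: cpow_bound. Qed.

Let cQ : continuous Q. Proof. exact: cpow_continuous. Qed.

(** One term of the sum bounds |f x|^r mu(x), and mu(x) is at least mu0.  Hence
    the clamp at [K] does nothing along a solution with energy at most [N]. *)
Lemma sums_le_sup f x : sums_le w r N f -> `|f x| <= K.
Proof.
move=> fN; have := fN [:: x] isT; rewrite big_seq1 => fx.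
have m0 : 0 < mu0 := wg_mu0 wg.
have fxN : `|f x| `^ r <= N / mu0.
  rewrite ler_pdivlMr// (le_trans _ fx)// ler_wpM2l ?powR_ge0//.
  exact: vmeas_ge_inf.
have -> : `|f x| = (`|f x| `^ r) `^ r^-1.
  by rewrite -powRrM mulfV ?gt_eqF// powRr1.
apply: ge0_ler_powR => //; rewrite ?nnegrE ?powR_ge0 ?invr_ge0 ?(ltW r0)//.
by rewrite divr_ge0// ltW.
Qed.

Let Qid f : sums_le w r N f -> (fun y => Q (f y)) = (fun y => spow (f y) q).
Proof.
move=> fN; apply/funext => y; rewrite /Q /cpow clamp_id//.
exact: sums_le_sup.
Qed.

Definition ball_flow n (u : V -> R -> R) : Prop :=
  [/\ flow (laplace_on w p Q (gball w x0 n)) u,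
      forall x, gball w x0 n x -> u x 0 = u0 x,
      forall x (t : R), ~ gball w x0 n x -> 0 <= t -> u x t = 0
    & forall t : R, 0 <= t -> sums_le w r N (u ^~ t)].

Lemma ball_flow_exists n : exists u, ball_flow n u.
Proof.
set B := gball w x0 n.
pose f x := if x \in B then u0 x else 0.
have [u [uF uf]] := @peano_existence R V (laplace_on w p Q B) ((C + C) `^ (p - 1))
  (fun x => laplace_on_continuous wg (x := x) p1 cQ)
  (fun x g => laplace_on_bound wg B x g p1 QC) f.
have uB0 x : ~ B x -> u x 0 = 0 by move=> nBx; rewrite uf /f memNset.
exists u; split => //.
- by move=> x Bx; rewrite uf /f mem_set.
- by move=> x t nBx t0; exact: (flow_on_out uF uB0).
move=> t t0 D uD.
have [E uE nE] := finite_closed_nbhd w (finite_gball wg x0 n).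
(* The energy estimate needs the neighbours of the ball in the range of sums. *)
pose E' := undup (D ++ E).
have uE' : uniq E' := undup_uniq _.
have term0 g x : 0 <= `|g x : R| `^ r * vmeas w x.
  by rewrite mulr_ge0 ?powR_ge0// ltW// vmeas_gt0.
apply: (@le_trans _ _ (\sum_(x <- E') `|u x t| `^ r * vmeas w x)).
  apply: sum_sub_le => // [x xD|x]; last exact: (term0 (u ^~ t)).
  by rewrite mem_undup mem_cat xD.
apply: (@le_trans _ _ (\sum_(x <- E') `|u x 0| `^ r * vmeas w x)).
  have nE' x : B x -> {subset nbhd w x <= E'}.
    by move=> Bx y yx; rewrite mem_undup mem_cat (nE _ Bx) ?orbT.
  exact: (energy_nonincreasing wg (@cpow_le _ K _ q0) r1 uE' nE' uF uB0 t0).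
apply: le_trans (u0N uE'); apply: ler_sum => x _.
rewrite uf /f; case: ifP => _ //.
by rewrite normr0 powR0 ?gt_eqF// mul0r (term0 u0).
Qed.

(** The energy bound removes the truncation. *)
Lemma ball_flow_mixed n u : ball_flow n u -> mixed_solution w p q u0 x0 n u.
Proof.
move=> [uF u_in u_out uN]; split => //.
- by move=> x; apply: (flow_C1 uF); exact: laplace_on_continuous.
move=> x t Bx t0; have := flow_is_derive uF x t0.
rewrite laplace_on_in// Qid//; exact/uN/ltW.
Qed.

(** The solutions on the balls are approximate solutions for the truncated
    p-Laplacian of the whole graph, with no error term. *)
Lemma exhaustion_solution_exists : exists u, exhaustion_solution w p q r u0 x0 u.
Proof.
have [v vP] := choice ball_flow_exists.
have [U [UU ooU]] := eventually_ultrafilter.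
have PU : ProperFilter U by exact: ultra_proper.
have vF k : flow (laplace_on w p Q (gball w x0 k)) (v k) by have [] := vP k.
have vN k t : 0 <= t -> sums_le w r N (v k ^~ t) by have [_ _ _] := vP k; exact.
(* Negative times are sent to 0, the bounds being available on [0, +oo). *)
have vK xt : exists C, forall k, `|v k xt.1 (Num.max 0 xt.2)| <= C.
  exists K => k; apply: (sums_le_sup (f := v k ^~ _)).
  by apply: vN; rewrite le_max lexx.
have [a va] := ultrafilter_pointwise_limit UU vK.
pose u x t := a (x, t).
have vu x t : 0 <= t -> v k x t @[k --> U] --> u x t.
  by move=> t0; have := va (x, t); rewrite /= max_r.
have uN t : 0 <= t -> sums_le w r N (u ^~ t).
  move=> t0 D uD; apply: (@ler_cvg_to _ U _ _
    (fun k => \sum_(x <- D) `|v k x t| `^ r * vmeas w x) (fun=> N)).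
  - elim: D {uD} => [|x D IH].
      by rewrite big_nil; under eq_fun do rewrite big_nil; exact: cvg_cst.
    rewrite big_cons; under eq_fun do rewrite big_cons.
    apply: cvgD IH; apply: cvgM; last exact: cvg_cst.
    apply: (cvg_comp (fun k => v k x t) (fun h => `|h| `^ r) (vu x t t0)).
    have [+ _] := is_derive_normr_powR (u x t) r1.
    by move=> /derivable1_diffP/differentiable_continuous.
  - exact: cvg_cst.
  - by apply: filterE => k; exact: vN.
pose F x (f : V -> R) := plaplace w p (fun y => Q (f y)) x.
have cF x : ptws_continuous (F x) by exact: plaplace_continuous.
have bF x f : `|F x f| <= (C + C) `^ (p - 1) by exact: plaplace_bound.
have vapprox : approx_flow F v (fun=> 0).
  move=> x; apply: filterS (gball_near w x0 x) => k Bx s t c eps s0 st near_c.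
  have [tau stau ->] := flow_MVT (vF k) x s0 st.
  rewrite laplace_on_in// mulr0 addr0 mulrC -mulrBr normrM mulrC.
  by rewrite (ger0_norm (_ : 0 <= t - s)) ?subr_ge0// ler_wpM2r ?subr_ge0 ?near_c.
have zero_cvg : (fun=> 0) k @[k --> \oo] --> (0 : R) by exact: cvg_cst.
have uF : flow F u by exact: (flow_limit (PU := PU) bF vapprox cF zero_cvg ooU vu).
have [phi [phi1 phi_lt phi_u]] := pointwise_subsequence PU ooU zero_cvg vu
  (approx_flow_lipschitz bF vapprox)
  (flow_limit_lipschitz (PU := PU) bF vapprox zero_cvg ooU vu).
exists u; split; last first.
  exists v, phi; split => // k; exact: ball_flow_mixed.
split.
- split.
  + move=> t [t0 _]; apply: le_lt_trans (sums_le_lnorm wg r0 (uN _ t0)) _.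
    by rewrite ltry.
  + move=> x; apply: subspace_continuous_measurable_fun;
      last exact: flow_continuous uF x.
    have -> : time_interval (+oo : \bar R) = `[0, +oo[%classic.
      apply/seteqP; split => t /=; rewrite in_itv/= andbT; first by case.
      by move=> t0; split => //; rewrite ltry.
    exact: measurable_itv.
  + exists (N `^ r^-1); apply: aeW => t [t0 _].
    by apply: sums_le_lnorm => //; exact: uN.
- by move=> x; exact: (flow_C1 uF).
- move=> x t t0 _; have := flow_is_derive uF x t0.
  by rewrite /F Qid//; exact/uN/ltW.
move=> x; have v0 : v k x 0 @[k --> U] --> u0 x.
  apply: cvg_near_cst; apply: ooU; apply: filterS (gball_near w x0 x) => k Bx.
  by have [_ -> ] := vP k.
exact: (cvg_unique _ (vu x 0 (lexx 0)) v0).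
Qed.

End Exhaustion.

Theorem theorem1p3 (R : realType) (V : countType) (w : V -> V -> R)
    (x0 : V) (p q r : R) (u0 : V -> R) :
  weighted_graph w -> 1 < p -> 0 < q -> 1 < r -> lspace w r u0 ->
  exists u : V -> R -> R, exhaustion_solution w p q r u0 x0 u.
Proof.
move=> wg p1 q0 r1 u0r.
have [N u0N] := lspace_sums_le wg (lt_trans ltr01 r1) u0r.
exact: (exhaustion_solution_exists x0 wg p1 q0 r1 u0N).
Qed.
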